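(* Let $n,d\ge1$, $X_n\in\mathbb{R}^{n\times d}$, $y_n\in\mathbb{R}^n$ be deterministic and $\lambda_n>0$, with $H_n,A_n,\beta_n,r_n$ as in the context. For a scalar random variable $s$ with $\mathbb{E}s=0$, $\mathbb{E}s^2=1$ and $\mathbb{E}|s|^4<\infty$, let $\Omega_n$ be the first-order covariance matrix defined in the context for a sketch with i.i.d. entries distributed as $s$, and let $\Omega_n^{\mathrm{Rad}}$ denote the same matrix when $s$ has the Rademacher law $\mathbb{P}(s=1)=\mathbb{P}(s=-1)=1/2$. Then $\mathbb{E}s^4\ge1$, with equality if and only if $s$ has the Rademacher law, and $$\Omega_n-\Omega_n^{\mathrm{Rad}}=\frac{\mathbb{E}s^4-1}{n^2}\,A_nX_n^\top\operatorname{diag}(r_n\odot r_n)X_nA_n^\top\succeq 0 .$$ Thus, among sketches with i.i.d. entries of mean zero and variance one, Rademacher entries yield the smallest first-order covariance matrix in the Loewner order.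
   Context: Define $H_n:=\frac1n X_n^\top X_n$, $A_n:=(H_n+\lambda_n I_d)^{-1}$, $\beta_n:=A_n\frac1nX_n^\top y_n$ (the ridge solution minimizing $\frac1n\|X_n\beta-y_n\|_2^2+\lambda_n\|\beta\|_2^2$), and $r_n:=y_n-X_n\beta_n$. First-order covariance matrix: if $\mathbf{s}\in\mathbb{R}^n$ is a random vector whose coordinates are i.i.d. copies of $s$, let $\psi_n(\mathbf{s}):=\frac1nA_nX_n^\top(\mathbf{s}\mathbf{s}^\top-I_n)r_n$ (a mean-zero vector, the influence vector of one sketch row) and $\Omega_n:=\mathbb{E}[\psi_n(\mathbf{s})\psi_n(\mathbf{s})^\top]$. This matrix is given by $$\Omega_n=A_n\left\{\frac{\|r_n\|_2^2}{n}H_n+\lambda_n^2\beta_n\beta_n^\top+\frac{\mathbb{E}s^4-3}{n^2}X_n^\top\operatorname{diag}(r_n\odot r_n)X_n\right\}A_n^\top .$$ $\odot$ is the componentwise product, $\operatorname{diag}(a)$ the diagonal matrix with diagonal $a$, and for symmetric matrices $N\succeq L$ means that $N-L$ is positive semidefinite (Loewner order). *)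

(* Defs.v *)
From HB Require Import structures.
From mathcomp Require Import all_boot all_order all_algebra.
From mathcomp Require Import all_classical all_reals all_analysis.

Set Implicit Arguments.
Unset Strict Implicit.
Unset Printing Implicit Defensive.

Import Order.TTheory GRing.Theory Num.Theory.
Import numFieldNormedType.Exports.

Local Open Scope classical_set_scope.
Local Open Scope ring_scope.

Definition gram (R : realType) (n d : nat) (X : 'M[R]_(n, d)) : 'M[R]_d :=
  n%:R^-1 *: (X^T *m X).

(* For 0 < lambda the matrix gram X + lambda I is positive definite, so invmx
   is its true inverse and not the default value of a singular matrix. *)
Definition ridge_inv (R : realType) (n d : nat) (X : 'M[R]_(n, d))
    (lambda : R) : 'M[R]_d :=
  invmx (gram X + lambda%:M).

Definition ridge_sol (R : realType) (n d : nat) (X : 'M[R]_(n, d))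
    (y : 'cV[R]_n) (lambda : R) : 'cV[R]_d :=
  ridge_inv X lambda *m (n%:R^-1 *: (X^T *m y)).

Definition residual (R : realType) (n d : nat) (X : 'M[R]_(n, d))
    (y : 'cV[R]_n) (lambda : R) : 'cV[R]_n :=
  y - X *m ridge_sol X y lambda.

Definition influence (R : realType) (n d : nat) (X : 'M[R]_(n, d))
    (y : 'cV[R]_n) (lambda : R) (s : 'cV[R]_n) : 'cV[R]_d :=
  n%:R^-1 *:
    (ridge_inv X lambda *m X^T *m (s *m s^T - 1%:M) *m residual X y lambda).

(* The matrix E[psi(S) psi(S)^T], with entrywise expectation, for the random
   vector S = (S_i)_i. The entries are finite when the S_i are independent with
   finite fourth moments; fine only projects them from \bar R to R. *)
Definition cov_first_order (R : realType) (n d : nat) (X : 'M[R]_(n, d))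
    (y : 'cV[R]_n) (lambda : R)
    (dT : measure_display) (T : measurableType dT) (P : probability T R)
    (S : 'I_n -> {RV P >-> R}) : 'M[R]_d :=
  \matrix_(i, j) fine 'E_P[fun w : T =>
    let psi := influence X y lambda (\col_k S k w) in (psi *m psi^T)%R i j]%E.

Definition mutually_independent (R : realType) (n : nat)
    (dT : measure_display) (T : measurableType dT) (P : probability T R)
    (S : 'I_n -> {RV P >-> R}) : Prop :=
  forall (J : {set 'I_n}) (B : 'I_n -> set R),
    (forall i, measurable (B i)) ->
    P (\bigcap_(i in [set` J]) (S i @^-1` B i)) =
    (\prod_(i in J) P (S i @^-1` B i))%E.

(* The copies may live on another probability space than s. *)
Definition iid_copies (R : realType) (n : nat)
    (dT : measure_display) (T : measurableType dT) (P : probability T R)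
    (s : {RV P >-> R})
    (dU : measure_display) (U : measurableType dU) (Q : probability U R)
    (S : 'I_n -> {RV Q >-> R}) : Prop :=
  mutually_independent S /\
  forall (i : 'I_n) (B : set R), measurable B ->
    distribution Q (S i) B = distribution P s B.

Definition standardized (R : realType)
    (dT : measure_display) (T : measurableType dT) (P : probability T R)
    (s : {RV P >-> R}) : Prop :=
  [/\ ('E_P[s] = 0)%E,
      ('E_P[fun w : T => (s w ^+ 2)%R] = 1)%E &
      ('E_P[fun w : T => (`|s w| ^+ 4)%R] < +oo)%E].

Definition fourth_moment (R : realType)
    (dT : measure_display) (T : measurableType dT) (P : probability T R)
    (s : {RV P >-> R}) : \bar R :=
  'E_P[fun w : T => (s w ^+ 4)%R]%E.

Definition rademacher (R : realType)
    (dT : measure_display) (T : measurableType dT) (P : probability T R)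
    (s : {RV P >-> R}) : Prop :=
  P (s @^-1` [set 1]) = (2^-1)%:E /\ P (s @^-1` [set -1]) = (2^-1)%:E.

Definition psd (R : realType) (d : nat) (M : 'M[R]_d) : Prop :=
  M^T = M /\ forall v : 'cV[R]_d, 0 <= (v^T *m M *m v) 0 0.

Definition loewner_le (R : realType) (d : nat) (L N : 'M[R]_d) : Prop :=
  [/\ L^T = L, N^T = N & psd (N - L)].

(* Main.v *)
Require Import Defs.
From HB Require Import structures.
From mathcomp Require Import all_boot all_order all_algebra.
From mathcomp Require Import all_classical all_reals all_analysis.
From mathcomp Require Import finmap measurable_realfun ring lra.

Set Implicit Arguments.
Unset Strict Implicit.
Unset Printing Implicit Defensive.

Import Order.TTheory GRing.Theory Num.Theory.
Import numFieldNormedType.Exports.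
Import HBNNSimple.

Local Open Scope classical_set_scope.
Local Open Scope ring_scope.

(** The entries of the covariance are combinations of the fourth-order mixed
    moments of the coordinates. By independence each of these factors into
    moments of [s]; a multiplicity 1 contributes the factor 0, so the third
    moment never survives, and the only value depending on the law of [s] is the
    one where all four indices coincide, namely the fourth moment. This gives
    the difference formula, whose matrix is a congruence of a nonnegative
    diagonal one. Finally [E (s^2 - 1)^2 = E s^4 - 1], which vanishes iff
    [s = 1] or [s = -1] almost surely, and mean zero then balances the masses. *)

(** * Means of real-valued integrable functions *)

(** Integrability and a real value are bundled so that means can be added, scaled and compared in
    [R], without finiteness conditions in [\bar R]. *)
Definition has_mean (R : realType) (dT : measure_display)
    (T : measurableType dT) (P : probability T R) (f : T -> R) (v : R) : Prop :=
  P.-integrable setT (EFin \o f) /\ (\int[P]_w (f w)%:E = v%:E)%E.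

Section has_mean.
Context (R : realType) (dT : measure_display) (T : measurableType dT)
  (P : probability T R).
Implicit Types (f g : T -> R) (u v c : R).

Lemma has_mean_measurable f v : has_mean P f v -> measurable_fun setT f.
Proof. by move=> [/integrableP[/measurable_EFinP]]. Qed.

Lemma has_mean_expectation f v : has_mean P f v -> ('E_P[f] = v%:E)%E.
Proof. by move=> [_ <-]; rewrite unlock. Qed.

Lemma has_mean_unique f u v : has_mean P f u -> has_mean P f v -> u = v.
Proof. by move=> [_ fu] [_ fv]; move: fu; rewrite fv => -[]. Qed.

Lemma eq_has_mean f g v : f =1 g -> has_mean P f v -> has_mean P g v.
Proof. by move=> /funext ->. Qed.

Lemma integrable_has_mean f : P.-integrable setT (EFin \o f) ->
  exists v, has_mean P f v.
Proof.
move=> fint; exists (fine (\int[P]_w (f w)%:E)%E); split=> //.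
by rewrite fineK//; exact: integrable_fin_num.
Qed.

Lemma ge0_has_mean f v : measurable_fun setT f -> (forall w, 0 <= f w) ->
  (\int[P]_w (f w)%:E = v%:E)%E -> has_mean P f v.
Proof.
move=> mf f0 fv; split=> //; apply/integrableP; split.
  exact/measurable_EFinP.
under eq_integral do rewrite /= ger0_norm//.
by rewrite fv ltry.
Qed.

Lemma has_mean_cst c : has_mean P (fun=> c) c.
Proof.
split; first exact: finite_measure_integrable_cst.
by rewrite integral_cst//= probability_setT mule1.
Qed.

Lemma has_meanZ c f v : has_mean P f v -> has_mean P (fun w => c * f w) (c * v).
Proof.
move=> [fint fv]; split.
  apply: (@eq_integrable _ _ _ _ _ _ (fun w => c%:E * (f w)%:E)%E) => //.
  exact: integrableZl.
by rewrite EFinM -fv -integralZl.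
Qed.

Lemma has_meanD f g u v : has_mean P f u -> has_mean P g v ->
  has_mean P (fun w => f w + g w) (u + v).
Proof.
move=> [fint fu] [gint gv]; split.
  apply: (@eq_integrable _ _ _ _ _ _ (fun w => (f w)%:E + (g w)%:E)%E) => //.
  exact: integrableD.
by rewrite EFinD -fu -gv -integralD.
Qed.

Lemma has_meanB f g u v : has_mean P f u -> has_mean P g v ->
  has_mean P (fun w => f w - g w) (u - v).
Proof.
move=> fu /(has_meanZ (-1)) gv.
by have := has_meanD fu gv; rewrite mulN1r; under eq_fun do rewrite mulN1r.
Qed.

Lemma has_mean_sum (I : Type) (r : seq I) (F : I -> T -> R) (V : I -> R) :
  (forall i, has_mean P (F i) (V i)) ->
  has_mean P (fun w => \sum_(i <- r) F i w) (\sum_(i <- r) V i).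
Proof.
move=> FV; elim: r => [|i r IH].
  by rewrite big_nil; under eq_fun do rewrite big_nil; exact: has_mean_cst.
rewrite big_cons; under eq_fun do rewrite big_cons.
exact: has_meanD.
Qed.

Lemma has_mean_indic (A : set T) : measurable A ->
  has_mean P \1_A (fine (P A)).
Proof.
move=> mA; split; first exact: integrable_indic.
by rewrite integral_indic// setIT fineK// fin_num_measure.
Qed.

Lemma le_has_mean f g v : measurable_fun setT f ->
  (forall w, `|f w| <= `|g w|) -> has_mean P g v -> exists u, has_mean P f u.
Proof.
move=> mf fg [gint _]; apply: integrable_has_mean.
apply: le_integrable gint => //; first exact/measurable_EFinP.
by move=> w _; rewrite /= lee_fin.
Qed.

(** Measurability of [f] is asked for separately, since [P] need not be complete. *)
Lemma ae_has_mean f g v : measurable_fun setT f ->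
  ae_eq P setT (EFin \o f) (EFin \o g) -> has_mean P g v -> has_mean P f v.
Proof.
move=> mf fg gv; have mg := has_mean_measurable gv; case: gv => gint gv.
have mEf : measurable_fun setT (EFin \o f) by exact/measurable_EFinP.
have mEg : measurable_fun setT (EFin \o g) by exact/measurable_EFinP.
split; last first.
  by rewrite -gv; exact: (ae_eq_integral (EFin \o g)).
apply/integrableP; split=> //.
case/integrableP: gint => _; apply: le_lt_trans.
rewrite le_eqVlt; apply/orP; left; apply/eqP.
apply: (ae_eq_integral (abse \o (EFin \o g))) => //; try exact: measurableT_comp.
exact: (ae_eq_comp abse).
Qed.

(** Monotone convergence with real values: as the means tend to a real [v], the limit function is
    integrable too. *)
Lemma monotone_has_mean (g : nat -> T -> R) (V : nat -> R) f v :
  (forall k, has_mean P (g k) (V k)) -> (forall k w, 0 <= g k w) ->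
  (forall w, {homo (g^~ w) : k l / (k <= l)%N >-> k <= l}) ->
  (forall w, (g k w)%:E @[k --> \oo] --> (f w)%:E) ->
  (V k)%:E @[k --> \oo] --> v%:E -> has_mean P f v.
Proof.
move=> gV g0 gnd gf Vv.
have mg k : measurable_fun setT (EFin \o g k).
  by apply/measurable_EFinP; exact: has_mean_measurable (gV k).
apply: ge0_has_mean.
- apply/measurable_EFinP; apply: (emeasurable_fun_cvg (fun k w => (g k w)%:E)) => //.
- move=> w; rewrite -lee_fin -(cvg_lim _ (gf w))//.
  apply: lime_ge; first by apply/cvg_ex; eexists; exact: gf.
  by apply: nearW => k; rewrite lee_fin.
- have -> : (\int[P]_w (f w)%:E = \int[P]_w limn (fun k => (g k w)%:E))%E.
    by apply: eq_integral => w _; rewrite (cvg_lim _ (gf w)).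
  rewrite monotone_convergence//; last 2 first.
  + by move=> k w _; rewrite lee_fin.
  + by move=> w _ k l kl; rewrite lee_fin; exact: gnd.
  under eq_fun do rewrite (gV _).2.
  exact: cvg_lim.
Qed.

End has_mean.

(** * Products of functions of independent variables *)

(** Serves the inductions over coordinates below, which exchange the factor at a single index. *)
Lemma prod_if_eq (R : comNzRingType) (I : finType) (j : I) (a : R)
    (F : I -> R) :
  \prod_i (if i == j then a else F i) = a * \prod_(i | i != j) F i.
Proof.
by rewrite (bigD1 j)//= eqxx; congr (_ * _); apply: eq_bigr => i /negPf ->.
Qed.

Section independence.
Context (R : realType) (n : nat) (dT : measure_display)
  (T : measurableType dT) (P : probability T R).

(* Taking [B = setT] in the hypothesis on [G] shows that [c] is its mean, so that
   [G] is uncorrelated with every event generated by [Z]. *)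
Lemma has_mean_mul_ge0 (Z : {RV P >-> R}) (G : T -> R) (c : R) :
  (forall w, 0 <= G w) ->
  (forall B, measurable B ->
    has_mean P (fun w => \1_B (Z w) * G w) (fine (P (Z @^-1` B)) * c)) ->
  forall (f : R -> R) (m : R), measurable_fun setT f -> (forall x, 0 <= f x) ->
  has_mean P (f \o Z) m -> has_mean P (fun w => f (Z w) * G w) (m * c).
Proof.
move=> G0 GB f m mf f0 fm.
have mEf : measurable_fun setT (EFin \o f) by exact/measurable_EFinP.
pose g := nnsfun_approx measurableT mEf.
pose s k := fset_set (g k @` setT).
pose V k := \sum_(i < #|` s k|)
  (s k)`_i * fine (P (Z @^-1` (g k @^-1` [set (s k)`_i]))).
(* A simple function is a finite combination of indicators of its level sets, so [GB] extends to it
   by linearity. *)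
have gE k x :
    g k x = \sum_(i < #|` s k|) ((s k)`_i * \1_(g k @^-1` [set (s k)`_i]) x).
  exact: fimfunEord.
have mpre k (y : R) : measurable (g k @^-1` [set y]).
  exact: measurable_funPTI.
have gV k : has_mean P (g k \o Z) (V k).
  have := @has_mean_sum _ _ _ P _ (index_enum 'I_#|` s k|)
    (fun i w => (s k)`_i * \1_(g k @^-1` [set (s k)`_i]) (Z w))
    (fun i => (s k)`_i * fine (P (Z @^-1` (g k @^-1` [set (s k)`_i])))).
  move=> /(_ _)/eq_has_mean; apply=> [w|i]; first by rewrite [in RHS]/= gE.
  apply: has_meanZ; apply: (@has_mean_indic _ _ _ P (Z @^-1` _)).
  exact: measurable_funPTI.
have gVc k : has_mean P (fun w => g k (Z w) * G w) (V k * c).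
  rewrite /V mulr_suml.
  have := @has_mean_sum _ _ _ P _ (index_enum 'I_#|` s k|)
    (fun i w => (s k)`_i * (\1_(g k @^-1` [set (s k)`_i]) (Z w) * G w))
    (fun i => (s k)`_i * (fine (P (Z @^-1` (g k @^-1` [set (s k)`_i]))) * c)).
  under eq_bigr do rewrite mulrA.
  move=> /(_ _)/eq_has_mean; apply=> [w|i]; last exact/has_meanZ/GB.
  by rewrite gE mulr_suml; apply: eq_bigr => i _; rewrite mulrA.
have gnd x : {homo (g^~ x) : k l / (k <= l)%N >-> k <= l}.
  by move=> k l kl; exact/lefP/nd_nnsfun_approx.
have gf x : (g k x)%:E @[k --> \oo] --> (f x)%:E.
  by apply: (cvg_nnsfun_approx measurableT mEf) => // y _; rewrite lee_fin.
(* Monotone convergence for [f \o Z] identifies the limit of [V k]; the means [V k * c] of the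
   products with [G] then tend to [m * c]. *)
have Vm : (V k)%:E @[k --> \oo] --> m%:E.
  rewrite -fm.2.
  under eq_fun do rewrite -(gV _).2.
  have -> : (\int[P]_w (f (Z w))%:E = \int[P]_w limn (fun k => (g k (Z w))%:E))%E.
    by apply: eq_integral => w _; rewrite (cvg_lim _ (gf _)).
  apply: cvg_monotone_convergence => //.
  - by move=> k; apply/measurable_EFinP; exact: has_mean_measurable (gV k).
  - by move=> k w _; rewrite lee_fin.
  - by move=> w _ k l kl; rewrite lee_fin; exact: gnd.
apply: monotone_has_mean gVc _ _ _ _ => //=.
- by move=> k w; rewrite mulr_ge0.
- by move=> w k l kl; rewrite ler_wpM2r//; exact: gnd.
- move=> w; rewrite EFinM; under eq_fun do rewrite EFinM.
  exact: cvgeZr.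
- rewrite EFinM; under eq_fun do rewrite EFinM.
  exact: cvgeZr.
Qed.

Variable S : 'I_n -> {RV P >-> R}.
Hypothesis indepS : mutually_independent S.

(** The product rule for events over the full index set, read through indicators. *)
Let has_mean_prod_indic (B : 'I_n -> set R) :
  (forall i, measurable (B i)) ->
  has_mean P (fun w => \prod_i \1_(B i) (S i w))
    (\prod_i fine (P (S i @^-1` B i))).
Proof.
move=> mB.
pose A := \bigcap_(i in [set` [set: 'I_n]%SET]) (S i @^-1` B i).
have mA : measurable A.
  apply: fin_bigcap_measurable => // i _.
  exact: measurable_funPTI.
have := has_mean_indic P mA; rewrite /A indepS//.
have -> : (\prod_(i in [set: 'I_n]%SET) P (S i @^-1` B i))%E =
    (\prod_i fine (P (S i @^-1` B i)))%:E.
  rewrite -prodEFin; apply: eq_big => i; first by rewrite inE.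
  by move=> _; rewrite fineK// fin_num_measure//; exact: measurable_funPTI.
apply: eq_has_mean => w; rewrite indicE.
have [wA|wA] := boolP (w \in _).
  rewrite big1// => i _; rewrite indicE mem_set//.
  by move/set_mem: wA; apply=> /=; rewrite inE.
apply/esym/eqP/prodf_eq0; apply: contrapT => /forall2NP h.
move/negP: wA; apply; apply/mem_set => i _ /=.
case: (h i) => //; rewrite indicE.
by case: (asboolP (B i (S i w))) => // ?; rewrite memNset// eqxx.
Qed.

(** Induction on [k] passes from indicators to nonnegative functions one coordinate at a time: those
    of index at least [k] are still indicators, and [k = n] leaves no such constraint. *)
Let has_mean_prod_ge0 (k : nat) (f : 'I_n -> R -> R) (m : 'I_n -> R) :
  (forall i, measurable_fun setT (f i)) -> (forall i x, 0 <= f i x) ->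
  (forall i, has_mean P (f i \o S i) (m i)) ->
  (forall i : 'I_n, (k <= i)%N -> exists2 B, measurable B & f i = \1_B) ->
  has_mean P (fun w => \prod_i f i (S i w)) (\prod_i m i).
Proof.
elim: k f m => [|k IH] f m mf f0 fm fB.
  have /choice[B BP] : forall i, exists B, measurable B /\ f i = \1_B.
    by move=> i; have [//|B ? ?] := fB i; exists B.
  have fE : f = fun i => \1_(B i) by apply/funext => i; rewrite (BP i).2.
  have -> : m = fun i => fine (P (S i @^-1` B i)).
    apply/funext => i; apply: has_mean_unique (fm i) _; rewrite fE.
    apply: (@has_mean_indic _ _ _ P (S i @^-1` B i)).
    by apply: measurable_funPTI => //; exact: (BP i).1.
  by rewrite fE; apply: has_mean_prod_indic => i; exact: (BP i).1.
(* For [n <= k] no coordinate has index at least [k], so the induction hypothesis applies to the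
   same family. *)
have [kn|nk] := ltnP k n; last first.
  by apply: (IH f m) => // i ki; have := leq_trans nk ki; rewrite leqNgt ltn_ord.
pose j := Ordinal kn.
rewrite (bigD1 j)//=; under eq_fun do rewrite (bigD1 j)//=.
apply: (has_mean_mul_ge0 (Z := S j)) => //.
- by move=> w; exact: prodr_ge0.
(* The condition on indicators is the induction hypothesis for the family whose factor [j] is
   replaced by [\1_B]. *)
- move=> B mB.
  have := IH (fun i => if i == j then \1_B else f i)
             (fun i => if i == j then fine (P (S j @^-1` B)) else m i).
  rewrite prod_if_eq => /(_ _ _ _ _)/eq_has_mean; apply.
  + move=> w; rewrite -prod_if_eq; apply: eq_bigr => i _.
    by case: eqVneq => // ->.
  + by move=> i; case: eqP => // _; exact: measurable_indic.
  + by move=> i x; case: eqP => // _; rewrite indicE.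
  + move=> i; case: eqVneq => // ->.
    by apply: (@has_mean_indic _ _ _ P (S j @^-1` B)); exact: measurable_funPTI.
  + move=> i ki; case: eqVneq => [_|ij]; first by exists B.
    apply: fB; rewrite ltn_neqAle ki andbT; apply: contra ij => /eqP kE.
    exact/eqP/val_inj.
Qed.

Lemma has_mean_prod (f : 'I_n -> R -> R) (m : 'I_n -> R) :
  (forall i, measurable_fun setT (f i)) ->
  (forall i, has_mean P (f i \o S i) (m i)) ->
  has_mean P (fun w => \prod_i f i (S i w)) (\prod_i m i).
Proof.
(* Induction on the number of coordinates allowed to change sign: those of index at least [k] are
   nonnegative. *)
suff H (k : nat) : forall f m, (forall i, measurable_fun setT (f i)) ->
    (forall i, has_mean P (f i \o S i) (m i)) ->
    (forall i : 'I_n, (k <= i)%N -> forall x, 0 <= f i x) ->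
    has_mean P (fun w => \prod_i f i (S i w)) (\prod_i m i).
  by move=> mf fm; apply: (H n) => // i; rewrite leqNgt ltn_ord.
elim: k => [|k IH] {}f {}m mf fm f0.
  apply: (@has_mean_prod_ge0 n) => // [i x|i]; first exact: f0.
  by rewrite leqNgt ltn_ord.
have [kn|nk] := ltnP k n; last first.
  by apply: IH => // i ki; have := leq_trans nk ki; rewrite leqNgt ltn_ord.
pose j := Ordinal kn.
(* [f j] is the difference of the nonnegative integrable functions [f1] and [f2], and the product is
   linear in its factor [j]. *)
pose f1 x := `|f j x|; pose f2 x := `|f j x| - f j x.
have mf1 : measurable_fun setT f1 by exact: measurableT_comp.
have mf2 : measurable_fun setT f2 by exact: measurable_funB.
have [m1 f1m] : exists m1, has_mean P (f1 \o S j) m1.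
  by apply: integrable_has_mean; exact: integrable_norm (fm j).1.
have f2m : has_mean P (f2 \o S j) (m1 - m j) by exact: (has_meanB f1m (fm j)).
have step g v : measurable_fun setT g -> has_mean P (g \o S j) v ->
    (forall x, 0 <= g x) ->
    has_mean P (fun w => g (S j w) * \prod_(i | i != j) f i (S i w))
      (v * \prod_(i | i != j) m i).
  move=> mg gv g0.
  have := IH (fun i => if i == j then g else f i)
             (fun i => if i == j then v else m i).
  rewrite prod_if_eq => /(_ _ _ _)/eq_has_mean; apply.
  + move=> w; rewrite -prod_if_eq; apply: eq_bigr => i _.
    by case: eqVneq => // ->.
  + by move=> i; case: eqP.
  + by move=> i; case: eqVneq => // ->.
  + move=> i ki x; case: eqVneq => // ij.
    apply: f0; rewrite ltn_neqAle ki andbT; apply: contra ij => /eqP kE.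
    exact/eqP/val_inj.
have h1 := step f1 m1 mf1 f1m (fun x => normr_ge0 _).
have f20 x : 0 <= f2 x by rewrite subr_ge0 ler_norm.
have h2 := step f2 _ mf2 f2m f20.
have := has_meanB h1 h2; rewrite [X in _ -> has_mean _ _ X](bigD1 j)//=.
have -> : m1 * \prod_(i | i != j) m i - (m1 - m j) * \prod_(i | i != j) m i =
    m j * \prod_(i | i != j) m i by ring.
apply: eq_has_mean => w; rewrite [RHS](bigD1 j)//= /f1 /f2; ring.
Qed.

End independence.

(** * Equality in law, and moments of standardized and Rademacher variables *)

Lemma normr_exp4 (R : realDomainType) (x : R) : `|x| ^+ 4 = x ^+ 4.
Proof. by rewrite -normrX ger0_norm ?exprn_even_ge0. Qed.

Lemma eq1N1 (R : numDomainType) : (1 == -1 :> R) = false.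
Proof. by rewrite -subr_eq0 opprK -mulr2n pnatr_eq0. Qed.

(** Both means are integrals over the real line against image measures that agree on measurable
    sets. *)
Lemma has_mean_law (R : realType) (dT : measure_display)
    (T : measurableType dT) (P : probability T R) (s : {RV P >-> R})
    (dU : measure_display) (U : measurableType dU) (Q : probability U R)
    (Z : {RV Q >-> R}) (f : R -> R) (v : R) :
  (forall B, measurable B -> distribution Q Z B = distribution P s B) ->
  measurable_fun setT f -> has_mean P (f \o s) v -> has_mean Q (f \o Z) v.
Proof.
move=> law mf [sint sv].
have mEf : measurable_fun setT (EFin \o f) by exact/measurable_EFinP.
have lawE (g : R -> \bar R) : (\int[distribution Q Z]_x g x =
    \int[distribution P s]_x g x)%E.
  by apply: eq_measure_integral => B mB _; exact: law.
have mEf' := measurableT_comp mEf (@measurable_funPT _ _ _ _ Z).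
(* The signed change of variables presupposes integrability, which comes from the nonnegative one
   applied to the absolute value of [f]. *)
have Zint : Q.-integrable setT (EFin \o (f \o Z)).
  apply/integrableP; split; first exact: mEf'.
  case/integrableP: sint => _.
  have mabs := measurableT_comp (@abse_measurable R setT) mEf.
  have := ge0_integral_distribution Z mabs (fun=> abse_ge0 _).
  have := ge0_integral_distribution s mabs (fun=> abse_ge0 _).
  by rewrite -lawE => <- <-.
split=> //; rewrite -sv.
have := integral_distribution mEf sint.
by rewrite -lawE (integral_distribution mEf Zint).
Qed.

Section standardized_moments.
Context (R : realType) (dT : measure_display) (T : measurableType dT)
  (P : probability T R) (s : {RV P >-> R}).

(** [M] is a total function for convenience; its values beyond order 4 carry no meaning, and the
    third moment is only known to exist. *)
Lemma standardized_moments : standardized s ->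
  exists M : nat -> R,
    [/\ forall k, (k <= 4)%N -> has_mean P (fun w => s w ^+ k) (M k),
        M 0%N = 1, M 1%N = 0, M 2%N = 1 & fourth_moment s = (M 4%N)%:E].
Proof.
case=> s1 s2 s4.
have mX k : measurable_fun setT (fun w => s w ^+ k).
  by apply: measurable_funX; exact: measurable_funPT.
have [v4 Hv4] : exists v, has_mean P (fun w => s w ^+ 4) v.
  apply: integrable_has_mean; apply/integrableP; split.
    exact/measurable_EFinP.
  move: s4; rewrite unlock; congr (_ < _)%E; apply: eq_integral => w _ /=.
  by rewrite normrX.
(* Domination by [1 + s ^+ 4]: the term 1 bounds the power where [|s| <= 1], the term [s ^+ 4] where
   [|s| >= 1]. *)
have ex k : (k <= 4)%N -> exists v, has_mean P (fun w => s w ^+ k) v.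
  move=> k4; apply: (le_has_mean (g := fun w => 1 + s w ^+ 4)) => //; last first.
    exact: has_meanD (has_mean_cst _ _) Hv4.
  move=> w; rewrite normrX -normr_exp4 [leRHS]ger0_norm; last first.
    by rewrite addr_ge0// exprn_ge0.
  have [le1|/ltW ge1] := leP `|s w| 1.
    by rewrite (le_trans (exprn_ile1 _ (normr_ge0 _) le1))// lerDl exprn_ge0.
  by rewrite (le_trans (ler_weXn2l ge1 k4))// lerDr.
have ex' k : exists v, (k <= 4)%N -> has_mean P (fun w => s w ^+ k) v.
  (* Beyond order 4 the witness 0 is a placeholder. *)
  have [k4|k4] := boolP (k <= 4)%N; last by exists 0.
  by have [v ?] := ex k k4; exists v.
have [M HM] := choice ex'.
exists M; split=> //.
- by apply: has_mean_unique (HM 0%N _) (has_mean_cst _ _).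
- have := has_mean_expectation (HM 1%N isT).
  by under eq_fun do rewrite expr1; rewrite s1 => -[].
- by have := has_mean_expectation (HM 2%N isT); rewrite s2 => -[].
- exact: has_mean_expectation (HM 4%N isT).
Qed.

(** Expand the square and use [E s^2 = 1]. Nonnegativity of this mean gives the lower bound on the
    fourth moment, its vanishing the equality case. *)
Lemma standardized_sqr_deviation (m4 : R) : standardized s ->
  fourth_moment s = m4%:E ->
  has_mean P (fun w => (s w ^+ 2 - 1) ^+ 2) (m4 - 1).
Proof.
move=> /standardized_moments[M [HM _ _ M2 ->]] [<-].
have := has_meanD (HM 4%N isT)
  (has_meanD (has_meanZ (-2) (HM 2%N isT)) (has_mean_cst P 1)).
rewrite M2 (_ : M 4%N + _ = M 4%N - 1); last by ring.
by apply: eq_has_mean => w; ring.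
Qed.

Lemma fourth_moment_ge1 : standardized s -> (1 <= fourth_moment s)%E.
Proof.
move=> s_std; have [M [_ _ _ _ E]] := standardized_moments s_std.
have [_ H] := standardized_sqr_deviation s_std E.
rewrite E lee_fin -subr_ge0 -lee_fin -H integral_ge0// => w _.
by rewrite lee_fin sqr_ge0.
Qed.

Let m_pre (x : R) : measurable (s @^-1` [set x]).
Proof. exact: measurable_funPTI. Qed.

(** Almost surely [f(s)] is a combination of the indicators of the two level sets. The masses are
    left free because the equality case has to determine them. *)
Lemma has_mean_two_point (f : R -> R) :
  {ae P, forall w, s w = 1 \/ s w = -1} -> measurable_fun setT f ->
  has_mean P (f \o s)
    (f 1 * fine (P (s @^-1` [set 1])) + f (-1) * fine (P (s @^-1` [set -1]))).
Proof.
move=> s_ae mf.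
have := has_meanD (has_meanZ (f 1) (has_mean_indic P (m_pre 1)))
  (has_meanZ (f (-1)) (has_mean_indic P (m_pre (-1)))).
apply: ae_has_mean.
  by apply: measurableT_comp => //; exact: measurable_funPT.
apply: filterS s_ae => w sw _ /=; congr (_%:E); rewrite !indicE.
have inE' (x : R) : (w \in s @^-1` [set x]) = (s w == x).
  by apply/idP/eqP => [/set_mem|/mem_set].
rewrite !inE'; case: sw => ->; rewrite eqxx.
  by rewrite eq1N1 mulr1 mulr0 addr0.
by rewrite eq_sym eq1N1 mulr1 mulr0 add0r.
Qed.

(** The two disjoint masses add up to 1, so the complement is a null set. *)
Lemma rademacher_ae : rademacher s -> {ae P, forall w, s w = 1 \/ s w = -1}.
Proof.
move=> [p1 pN1]; exists (~` (s @^-1` [set 1] `|` s @^-1` [set -1])); split.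
- by apply: measurableC; exact: measurableU.
- rewrite probability_setC; last exact: measurableU.
  rewrite measureU//; last first.
    by rewrite -subset0 => w [/= -> /eqP]; rewrite eq1N1.
  rewrite -[X in (_ - X)%E]/(P (s @^-1` [set 1%R]) + P (s @^-1` [set (-1)%R]))%E.
  rewrite p1 pN1 -EFinD (_ : 2^-1 + 2^-1 = 1); last by field.
  by rewrite subrr.
- by move=> w /= h [] ?; apply: h; [left|right].
Qed.

Lemma has_mean_rademacher (f : R -> R) : rademacher s ->
  measurable_fun setT f -> has_mean P (f \o s) ((f 1 + f (-1)) / 2).
Proof.
move=> rs mf; have := has_mean_two_point (rademacher_ae rs) mf.
by case: rs => -> ->; rewrite /= -mulrDl.
Qed.

Lemma rademacher_moment k : rademacher s ->
  has_mean P (fun w => s w ^+ k) ((1 + (-1) ^+ k) / 2).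
Proof.
move=> rs; have := has_mean_rademacher rs (exprn_measurable k).
by rewrite expr1n.
Qed.

Lemma rademacher_standardized : rademacher s -> standardized s.
Proof.
move=> rs; split.
- have := has_mean_expectation (rademacher_moment 1 rs).
  rewrite expr1 subrr mul0r; exact.
- have := has_mean_expectation (rademacher_moment 2 rs).
  by rewrite (_ : _ / 2 = 1); last by rewrite sqrrN expr1n; lra.
- have := has_mean_expectation (rademacher_moment 4 rs).
  under eq_fun do rewrite -normr_exp4.
  by move=> ->; rewrite ltry.
Qed.

Lemma rademacher_fourth_moment : rademacher s -> fourth_moment s = 1%E.
Proof.
move=> rs; rewrite /fourth_moment (has_mean_expectation (rademacher_moment 4 rs)).
congr (_%:E); rewrite (_ : (-1) ^+ 4 = 1); last by rewrite -signr_odd expr0.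
lra.
Qed.

Lemma fourth_moment_eq1 : standardized s -> fourth_moment s = 1%E ->
  rademacher s.
Proof.
move=> s_std s4.
have Hdev := standardized_sqr_deviation s_std s4.
have s_ae : {ae P, forall w, s w = 1 \/ s w = -1}.
  have mdev := has_mean_measurable Hdev; case: Hdev => _; rewrite subrr => Hdev.
  (* A nonnegative function of integral zero vanishes almost everywhere. *)
  have : (\int[P]_w `|((s w ^+ 2 - 1) ^+ 2)%:E| = 0)%E.
    by rewrite -[RHS]Hdev; apply: eq_integral => w _; rewrite gee0_abs// lee_fin sqr_ge0.
  move=> /ae_eq_integral_abs; case=> //; first exact/measurable_EFinP.
  move=> N [mN PN hN]; exists N; split=> // w /= h; apply: hN => /= /(_ I) [].
  move/eqP; rewrite sqrf_eq0 subr_eq0 sqrf_eq1 => /orP[] /eqP ?; apply: h.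
    by left.
  by right.
have [M [HM M0 M1 _ _]] := standardized_moments s_std.
(* Orders 0 and 1 say that the two masses have sum 1 and difference 0. *)
have := has_mean_unique (has_mean_two_point s_ae (exprn_measurable 0)) (HM 0%N isT).
have := has_mean_unique (has_mean_two_point s_ae (exprn_measurable 1)) (HM 1%N isT).
rewrite M0 M1 !expr0 !expr1 => e1 e0; split.
  by rewrite -[LHS]fineK ?fin_num_measure//; congr (_%:E); lra.
by rewrite -[LHS]fineK ?fin_num_measure//; congr (_%:E); lra.
Qed.

End standardized_moments.

(** * Mixed moments up to order four *)

Section mixed_moments.
Context (R : realType) (n : nat).
Implicit Types (M : nat -> R) (p q : 'I_n * 'I_n).

(** The exponent of [x i] in the monomial [x p.1 * x p.2]. *)
Definition pair_count p (i : 'I_n) : nat := (p.1 == i) + (p.2 == i).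

(* If the [s_i] are i.i.d. with [k]-th moment [M k], this is the mean of
   [(s_a s_c - delta_ac) (s_b s_l - delta_bl)] for [p = (a, c)], [q = (b, l)]. *)
Definition mixed_moment M p q : R :=
  \prod_i M (pair_count p i + pair_count q i)%N
  - (p.1 == p.2)%:R * \prod_i M (pair_count q i)
  - (q.1 == q.2)%:R * \prod_i M (pair_count p i)
  + (p.1 == p.2)%:R * (q.1 == q.2)%:R.

Lemma prod_pair_count (x : 'I_n -> R) p :
  \prod_i x i ^+ pair_count p i = x p.1 * x p.2.
Proof.
have one j : \prod_i x i ^+ (j == i) = x j.
  by rewrite (bigD1 j)//= eqxx big1 ?mulr1// => i; rewrite eq_sym => /negPf ->.
by under eq_bigr do rewrite exprD; rewrite big_split/= !one.
Qed.

Lemma pair_count_le2 p i : (pair_count p i <= 2)%N.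
Proof. by rewrite /pair_count; case: eqP; case: eqP. Qed.

(** A single pair only meets moments of order at most 2, where [M] and [M'] agree. Two pairs have
    total multiplicity 4: a pattern with a 1 gives 0 for both, the pattern 2+2 gives 1 for both, and
    only a full coincidence separates them. *)
Lemma mixed_momentB M M' p q :
  M 0%N = 1 -> M 1%N = 0 -> M 2%N = 1 ->
  M' 0%N = 1 -> M' 1%N = 0 -> M' 2%N = 1 ->
  mixed_moment M p q - mixed_moment M' p q =
  (M 4%N - M' 4%N) * [&& p.1 == p.2, p.1 == q.1 & p.1 == q.2]%:R.
Proof.
move=> M0 M1 M2 M'0 M'1 M'2.
have le2 r : \prod_i M (pair_count r i) = \prod_i M' (pair_count r i).
  apply: eq_bigr => i _; have := pair_count_le2 r i.
  by case: (pair_count r i) => [|[|[|]]]//; rewrite (M0, M1, M2) (M'0, M'1, M'2).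
suff H : \prod_i M (pair_count p i + pair_count q i)%N -
    \prod_i M' (pair_count p i + pair_count q i)%N =
    (M 4%N - M' 4%N) * [&& p.1 == p.2, p.1 == q.1 & p.1 == q.2]%:R.
  by rewrite -H /mixed_moment !le2; ring.
have [/and3P[/eqP p12 /eqP pq1 /eqP pq2]|neq] :=
    boolP [&& p.1 == p.2, p.1 == q.1 & p.1 == q.2].
  have four (N : nat -> R) : N 0%N = 1 ->
      \prod_i N (pair_count p i + pair_count q i)%N = N 4%N.
    move=> N0; rewrite (bigD1 p.1)//= big1 ?mulr1.
      by rewrite /pair_count -p12 -pq1 -pq2 eqxx.
    by move=> i; rewrite /pair_count -p12 -pq1 -pq2 eq_sym => /negPf ->.
  by rewrite !four// mulr1.
rewrite mulr0; apply/eqP; rewrite subr_eq0; apply/eqP.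
have [/existsP[j /eqP j1]|/existsPn no1] :=
    boolP [exists j, pair_count p j + pair_count q j == 1]%N.
  by rewrite !(bigD1 (P := predT) j)//= j1 M1 M'1 !mul0r.
apply: eq_bigr => i _.
(* A multiplicity 3 leaves one index of multiplicity 1, and a multiplicity 4
   means that all four indices coincide. *)
suff : (pair_count p i + pair_count q i)%N \in [:: 0; 2]%N.
  by rewrite !inE => /orP[] /eqP ->; rewrite (M0, M2) (M'0, M'2).
have := no1 p.1; have := no1 p.2; have := no1 q.1; have := no1 q.2.
have := no1 i; move: neq; rewrite /pair_count.
case: p q {le2 no1} => a k [b l] /=.
(* Among the sixteen cases, four indices equal to [i] contradict [neq], exactly three contradict the
   multiplicity condition at the remaining index, exactly one contradicts it at [i]; two or none
   give the claim. *)
case: (eqVneq a i) => [->|/negPf ai]; case: (eqVneq k i) => [->|/negPf ki];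
  case: (eqVneq b i) => [->|/negPf bi]; case: (eqVneq l i) => [->|/negPf li];
  repeat match goal with
  | H : (?x == i) = false |- _ => rewrite ?(eq_sym i x) ?H; clear H
  end; by rewrite ?eqxx.
Qed.

End mixed_moments.

(** * The covariance of the influence vector *)

Section sketch.
Context (R : realType) (n d : nat) (X : 'M[R]_(n, d)) (y : 'cV[R]_n)
  (lambda : R).

Let C : 'M[R]_(d, n) := ridge_inv X lambda *m X^T.
Let r : 'cV[R]_n := residual X y lambda.

(** The influence vector is a centred quadratic form in the sketch row; these are the coefficients
    of its coordinate [i]. *)
Definition influence_coef (i : 'I_d) (p : 'I_n * 'I_n) : R :=
  n%:R^-1 * (C i p.1 * r p.2 0).

Lemma influenceE (s : 'cV[R]_n) (i : 'I_d) :
  influence X y lambda s i 0 =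
  \sum_p influence_coef i p * (s p.1 0 * s p.2 0 - (p.1 == p.2)%:R).
Proof.
rewrite /influence -/C -/r mxE mxE.
under eq_bigr do rewrite mxE mulr_suml.
rewrite exchange_big/= pair_big/= mulr_sumr; apply: eq_bigr => -[a k] _ /=.
by rewrite /influence_coef !mxE big_ord1 mxE /=; ring.
Qed.

(** Multiplying two centred monomials leaves monomials with exponents at most 4, whose means factor
    by independence and equality in law. *)
Lemma cov_first_orderE (dT : measure_display) (T : measurableType dT)
    (P : probability T R) (s : {RV P >-> R}) (M : nat -> R)
    (dU : measure_display) (U : measurableType dU) (Q : probability U R)
    (S : 'I_n -> {RV Q >-> R}) (i j : 'I_d) :
  (forall k, (k <= 4)%N -> has_mean P (fun w => s w ^+ k) (M k)) ->
  iid_copies s S ->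
  cov_first_order X y lambda S i j =
  \sum_p \sum_q influence_coef i p * influence_coef j q * mixed_moment M p q.
Proof.
move=> sM [indepS law].
have monomial (e : 'I_n -> nat) : (forall l, (e l <= 4)%N) ->
    has_mean Q (fun w => \prod_l S l w ^+ e l) (\prod_l M (e l)).
  move=> e4; apply: (has_mean_prod indepS (f := fun l x => x ^+ e l)) => l.
    exact: exprn_measurable.
  apply: (has_mean_law (s := s) _ (exprn_measurable (e l))); first exact: law.
  exact/sM/e4.
have pair4 (p : 'I_n * 'I_n) l : (pair_count p l <= 4)%N.
  exact: leq_trans (pair_count_le2 p l) _.
pose W p w := S p.1 w * S p.2 w - (p.1 == p.2)%:R.
have WW p q : has_mean Q (fun w => W p w * W q w) (mixed_moment M p q).
  have mpq := monomial (fun l => pair_count p l + pair_count q l)%N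
    (fun l => leq_add (pair_count_le2 p l) (pair_count_le2 q l)).
  have := has_meanD (has_meanB (has_meanB mpq
      (has_meanZ (p.1 == p.2)%:R (monomial _ (pair4 q))))
      (has_meanZ (q.1 == q.2)%:R (monomial _ (pair4 p))))
    (has_mean_cst Q ((p.1 == p.2)%:R * (q.1 == q.2)%:R)).
  apply: eq_has_mean => w; under eq_bigr do rewrite exprD.
  rewrite big_split/= !(prod_pair_count (fun l => S l w)) /W; ring.
(* The expectation is a real number, so [fine] loses nothing. *)
rewrite mxE (@has_mean_expectation _ _ _ Q _
  (\sum_p \sum_q influence_coef i p * influence_coef j q * mixed_moment M p q))//.
have := has_mean_sum (index_enum ('I_n * 'I_n)%type) (fun p =>
  has_mean_sum (index_enum ('I_n * 'I_n)%type) (fun q =>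
    has_meanZ (influence_coef i p * influence_coef j q) (WW p q))).
apply: eq_has_mean => w; cbv zeta.
rewrite [RHS]mxE big_ord1 [X in _ = _ * X]mxE !influenceE.
rewrite mulr_suml; apply: eq_bigr => p _.
rewrite mulr_sumr; apply: eq_bigr => q _.
by rewrite !mxE /W; ring.
Qed.

Lemma cov_first_order_sym (dU : measure_display) (U : measurableType dU)
    (Q : probability U R) (S : 'I_n -> {RV Q >-> R}) :
  (cov_first_order X y lambda S)^T = cov_first_order X y lambda S.
Proof.
apply/matrixP => i j; rewrite !mxE; congr fine; congr expectation.
apply/funext => w; cbv zeta; rewrite [LHS]mxE [RHS]mxE !big_ord1.
by rewrite [X in _ * X = _]mxE [X in _ = _ * X]mxE mulrC.
Qed.

(** The scalar is free so that any two standardized laws can be compared. The transpose is there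
    because [diag_mx] takes a row. *)
Definition cov_gap (k : R) : 'M[R]_d :=
  k *: (ridge_inv X lambda *m X^T *m diag_mx (map2_mx *%R r r)^T *m X
        *m (ridge_inv X lambda)^T).

Lemma cov_gapE k : cov_gap k = k *: (C *m diag_mx (map2_mx *%R r r)^T *m C^T).
Proof. by rewrite /cov_gap /C trmx_mul trmxK !mulmxA. Qed.

Lemma cov_gap_entry k i j :
  cov_gap k i j = k * \sum_a C i a * (r a 0) ^+ 2 * C j a.
Proof.
rewrite cov_gapE mxE mxE; congr (_ * _); apply: eq_bigr => a _.
by rewrite mul_mx_diag !mxE expr2.
Qed.

Lemma cov_gap_sym k : (cov_gap k)^T = cov_gap k.
Proof.
apply/matrixP => i j; rewrite mxE !cov_gap_entry; congr (_ * _).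
by apply: eq_bigr => a _; ring.
Qed.

(** With [u = C^T v] the quadratic form is [k] times the sum of the [r_a^2 u_a^2]. *)
Lemma cov_gap_psd k : 0 <= k -> psd (cov_gap k).
Proof.
move=> k0; split; first exact: cov_gap_sym.
move=> v; rewrite cov_gapE -scalemxAr -scalemxAl mxE mulr_ge0//.
have quadE (E : 'M[R]_n) :
    v^T *m (C *m E *m C^T) *m v = (C^T *m v)^T *m E *m (C^T *m v).
  by rewrite (trmx_mul C^T) trmxK !mulmxA.
rewrite quadE mxE sumr_ge0// => a _; rewrite mul_mx_diag !mxE.
by rewrite mulrAC -expr2 mulr_ge0 ?sqr_ge0.
Qed.

Lemma cov_first_orderB
    (dT : measure_display) (T : measurableType dT) (P : probability T R)
    (s : {RV P >-> R})
    (dT' : measure_display) (T' : measurableType dT') (P' : probability T' R)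
    (s' : {RV P' >-> R})
    (dU : measure_display) (U : measurableType dU) (Q : probability U R)
    (S : 'I_n -> {RV Q >-> R})
    (dU' : measure_display) (U' : measurableType dU') (Q' : probability U' R)
    (S' : 'I_n -> {RV Q' >-> R}) :
  standardized s -> standardized s' -> iid_copies s S -> iid_copies s' S' ->
  cov_first_order X y lambda S - cov_first_order X y lambda S' =
  cov_gap ((fine (fourth_moment s) - fine (fourth_moment s')) / n%:R ^+ 2).
Proof.
move=> /standardized_moments[M [sM M0 M1 M2 ->]].
move=> /standardized_moments[M' [sM' M'0 M'1 M'2 ->]] iidS iidS' /=.
apply/matrixP => i j; rewrite mxE [X in _ + X]mxE cov_gap_entry.
rewrite (cov_first_orderE i j sM iidS) (cov_first_orderE i j sM' iidS').
pose D p := \sum_q influence_coef i p * influence_coef j q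
  * (mixed_moment M p q - mixed_moment M' p q).
transitivity (\sum_a \sum_k D (a, k)).
  rewrite [RHS]pair_big/= -sumrB; apply: eq_bigr => -[a k] _.
  by rewrite -sumrB; apply: eq_bigr => q _; rewrite mulrBr.
rewrite mulr_sumr; apply: eq_bigr => a _; rewrite /D.
(* Only quadruples with four equal indices survive, so the sums over [k] and [q] collapse to [k = a]
   and [q = (a, a)]. *)
under eq_bigr do under eq_bigr do rewrite mixed_momentB//=.
rewrite (bigD1 a)//= [X in _ + X]big1 ?addr0; last first.
  move=> k /negPf ka; rewrite big1// => q _.
  by rewrite eq_sym ka !mulr0.
rewrite (bigD1 (a, a))//= [X in _ + X]big1 ?addr0; last first.
  move=> [b l]; rewrite xpair_eqE eqxx/= (eq_sym a b) (eq_sym a l) => /negPf ->.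
  by rewrite !mulr0.
rewrite eqxx /influence_coef /= -exprVn; ring.
Qed.

End sketch.

Theorem mainTheorem2 (R : realType) (n d : nat) (n_gt0 : (0 < n)%N)
    (d_gt0 : (0 < d)%N) (X : 'M[R]_(n, d)) (y : 'cV[R]_n)
    (lambda : R) (lambda_gt0 : 0 < lambda)
    (dT : measure_display) (T : measurableType dT) (P : probability T R)
    (s : {RV P >-> R}) (s_std : standardized s) :
  [/\ (1 <= fourth_moment s)%E,
      fourth_moment s = 1%E <-> rademacher s &
      forall (dT' : measure_display) (T' : measurableType dT')
        (P' : probability T' R) (s' : {RV P' >-> R}),
      rademacher s' ->
      standardized s' /\
      forall (dU : measure_display) (U : measurableType dU)
        (Q : probability U R) (S : 'I_n -> {RV Q >-> R})
        (dU' : measure_display) (U' : measurableType dU')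
        (Q' : probability U' R) (S' : 'I_n -> {RV Q' >-> R}),
      iid_copies s S -> iid_copies s' S' ->
      let A := ridge_inv X lambda in
      let r := residual X y lambda in
      let Omega := cov_first_order X y lambda S in
      let Omega_Rad := cov_first_order X y lambda S' in
      let Delta := ((fine (fourth_moment s) - 1) / n%:R ^+ 2) *:
        (A *m X^T *m diag_mx (map2_mx *%R r r)^T *m X *m A^T) in
      [/\ Omega - Omega_Rad = Delta,
          loewner_le 0 Delta &
          loewner_le Omega_Rad Omega]].
Proof.
split; first exact: fourth_moment_ge1.
  by split; [exact: fourth_moment_eq1|exact: rademacher_fourth_moment].
move=> dT' T' P' s' rs'; have s'_std := rademacher_standardized rs'.
split=> // dU U Q S dU' U' Q' S' iidS iidS' A r Omega Omega_Rad Delta.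
have gapE : Omega - Omega_Rad = Delta.
  by rewrite (cov_first_orderB X y lambda s_std s'_std iidS iidS')
    (rademacher_fourth_moment rs').
(* Finiteness of the fourth moment lets the bound by 1 pass through [fine]. *)
have k_ge0 : 0 <= (fine (fourth_moment s) - 1) / n%:R ^+ 2.
  have [M [_ _ _ _ s4]] := standardized_moments s_std.
  have := fourth_moment_ge1 s_std.
  by rewrite s4 lee_fin -subr_ge0 => ?; rewrite divr_ge0// exprn_ge0.
have Delta_psd : psd Delta by exact: cov_gap_psd.
split=> //; split.
- by rewrite trmx0.
- exact: Delta_psd.1.
- by rewrite subr0.
- exact: cov_first_order_sym.
- exact: cov_first_order_sym.
- by rewrite gapE.
Qed.
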